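(* Let $n\ge 4$ and let $C_{n,2}$ be the number of $2$-cycles in $G(n)$. Then $C_{n,2}=n+2$ if $n$ is even and $C_{n,2}=n+3$ if $n$ is odd. Moreover: If $n$ is even, no $2$-cycle uses two distinct edges with the same head and tail (i.e.\ no two $2$-cycles have the same two vertices), and every vertex contained in a $2$-cycle is contained in exactly one $2$-cycle, except for the two vertices $\mathbf a=1\,(\tfrac n2+1)\,2\,(\tfrac n2+2)\cdots(\tfrac n2-1)\,(n-1)\,\tfrac n2\,n$ (i.e.\ $a_{2i-1}=i$, $a_{2i}=\tfrac n2+i$ for $1\le i\le \tfrac n2$) and $\overline{\mathbf a}$, each of which is contained in exactly two $2$-cycles. If $n$ is odd, each vertex contained in a $2$-cycle forms $2$-cycles with exactly one other vertex, and exactly two pairs of vertices are joined by two edges with the same head and tail (each giving two $2$-cycles), namely the edges from $\mathbf a=\tfrac{n+1}{2}\,1\,\tfrac{n+3}{2}\,2\,\tfrac{n+5}{2}\cdots(n-1)\,\tfrac{n-1}{2}\,n$ (i.e.\ $a_{2i-1}=\tfrac{n-1}{2}+i$ for $1\le i\le\tfrac{n+1}{2}$ and $a_{2i}=i$ for $1\le i\le \tfrac{n-1}{2}$) to $\sigma(\mathbf a)$, and from $\overline{\mathbf a}$ to $\sigma(\overline{\mathbf a})$.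
   Context: For a sequence of distinct integers $c_1\cdots c_t$, $\mathrm{st}(c_1\cdots c_t)$ is the unique permutation $d_1\cdots d_t$ of $\{1,\dots,t\}$ with $d_i<d_j$ iff $c_i<c_j$. $G(n)$ is the directed multigraph whose vertices are the permutations of $\{1,\dots,n\}$ (one-line notation) and whose edges are the permutations $c_1\cdots c_{n+1}$ of $\{1,\dots,n+1\}$, the edge $c_1\cdots c_{n+1}$ going from $\mathrm{st}(c_1\cdots c_n)$ to $\mathrm{st}(c_2\cdots c_{n+1})$; so there can be several edges from one vertex to another. A $2$-cycle is a closed walk $(\mathbf u,e_1,\mathbf v,e_2,\mathbf u)$ with $\mathbf u\neq\mathbf v$, $e_1$ an edge from $\mathbf u$ to $\mathbf v$ and $e_2$ an edge from $\mathbf v$ to $\mathbf u$; closed walks differing only by the choice of starting vertex are identified, while ones with the same vertices but different edges are counted as distinct. The complement of $\mathbf a=a_1\cdots a_n$ is $\overline{\mathbf a}=(n+1-a_1)\cdots(n+1-a_n)$ and its cyclic shift is $\sigma(\mathbf a)=a_2\cdots a_na_1$. *)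

(* Defs.v *)
From mathcomp Require Import all_boot all_fingroup.

Set Implicit Arguments.
Unset Strict Implicit.
Unset Printing Implicit Defensive.

(* The permutations of {1, ..., n} are the elements of 'S_n, with positions and
   letters shifted down by one: u : 'S_n is the word (u 0 + 1) ... (u (n-1) + 1).
   [letter u i] is the i-th letter u_i of this word, where both i and u_i range
   over 1, ..., n; it is only meaningful for 1 <= i <= n. *)
Definition letter n (u : 'S_n) (i : nat) : nat :=
  nth 0 [seq (u j).+1 | j <- enum 'I_n] i.-1.

(* With letters 0, ..., n-1, the letter n + 1 - a_i becomes n - 1 - a_i, which
   is [rev_ord]. *)
Definition compl n (a : 'S_n) : 'S_n := (a * perm (@rev_ord_inj n))%g.

(* The product s * t of permutations maps x to t (s x). *)
Definition cshift n (a : 'S_n) : 'S_n := (perm (@ordS_inj n) * a)%g.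

Definition is_st t (c : 'I_t -> nat) (d : 'S_t) : bool :=
  [forall i, forall j, (d i < d j) == (c i < c j)].

Definition st t (c : 'I_t -> nat) : 'S_t := odflt 1%g [pick d | is_st c d].

Lemma is_st_uniq t (c : 'I_t -> nat) (d d' : 'S_t) :
  is_st c d -> is_st c d' -> d = d'.
Proof.
move=> /forallP cd /forallP cd'; apply/permP=> i; apply: val_inj.
have rankE (s : 'S_t) : nat_of_ord (s i) = #|[set j | s j < s i]|.
  rewrite -(card_imset _ (@perm_inj _ s)).
  have -> : s @: [set j | s j < s i] = [set k : 'I_t | k < s i].
    apply/setP=> k; rewrite inE; apply/imsetP/idP => [[j]|lt_k].
      by rewrite inE => lt_j ->.
    by exists (s^-1 k)%g; rewrite ?inE permKV.
  have le_t : s i <= t by apply: ltnW; apply: ltn_ord.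
  have -> : [set k : 'I_t | k < s i] = widen_ord le_t @: [set: 'I_(s i)].
    apply/setP=> k; rewrite inE; apply/idP/imsetP => [lt_k|[j _ ->]].
      by exists (Ordinal lt_k); rewrite ?inE //; apply: val_inj.
    exact: (ltn_ord j).
  rewrite card_imset ?cardsT ?card_ord //.
  by move=> x y /(congr1 val) /= /val_inj.
rewrite /= (rankE d) (rankE d'); apply: eq_card => j; rewrite !inE.
by rewrite (eqP (forallP (cd j) i)) (eqP (forallP (cd' j) i)).
Qed.

Lemma stP t (c : 'I_t -> nat) : injective c -> is_st c (st c).
Proof.
move=> c_inj; rewrite /st; case: pickP => //= no_st; exfalso.
pose r i := #|[set j | c j < c i]|.
have r_lt i : r i < t.
  rewrite -[X in _ < X]card_ord -cardsT; apply: proper_card.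
  by apply/properP; split; [apply: subsetT | exists i; rewrite ?inE ?ltnn].
have r_mono i j : c i < c j -> r i < r j.
  move=> lt_ij; apply: proper_card; apply/properP; split.
    by apply/subsetP=> k; rewrite !inE => /ltn_trans; apply.
  by exists i; rewrite !inE ?ltnn.
pose f i := Ordinal (r_lt i).
have f_inj : injective f.
  move=> i j /(congr1 val) /= r_ij; apply: c_inj.
  by case: (ltngtP (c i) (c j)) => // /r_mono; rewrite r_ij ltnn.
have /negP[] := negbT (no_st (perm f_inj)).
apply/forallP=> i; apply/forallP=> j; rewrite !permE /=; apply/eqP.
case: (ltngtP (c i) (c j)) => [/r_mono //|/r_mono lt_ji|/c_inj ->].
  by apply/negbTE; rewrite -leqNgt ltnW.
exact: ltnn.
Qed.

Section Graph.

Variable n : nat.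

(* Each e : 'S_n.+1 is an edge of G(n), from [edge_tail e] to [edge_head e]. *)
Definition edge_tail (e : 'S_n.+1) : 'S_n :=
  st (fun i : 'I_n => nat_of_ord (e (widen_ord (leqnSn n) i))).

Definition edge_head (e : 'S_n.+1) : 'S_n :=
  st (fun i : 'I_n => nat_of_ord (e (lift ord0 i))).

Definition edges (u v : 'S_n) : {set 'S_n.+1} :=
  [set e | (edge_tail e == u) && (edge_head e == v)].

(* ((u, e1), (v, e2)) stands for the closed walk (u, e1, v, e2, u). *)
Definition walk2 : finType := (('S_n * 'S_n.+1) * ('S_n * 'S_n.+1))%type.

Definition closed_walk2 (w : walk2) : bool :=
  let: ((u, e1), (v, e2)) := w in
  [&& u != v, e1 \in edges u v & e2 \in edges v u].

Definition rotate (w : walk2) : walk2 := (w.2, w.1).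

(* A 2-cycle is a class of closed walks under the choice of starting vertex. *)
Definition two_cycles : {set {set walk2}} :=
  [set [set w; rotate w] | w in closed_walk2].

(* Since a 2-cycle is closed under [rotate], all its vertices and edges occur
   as the first vertex and first edge of one of its walks. *)
Definition cycle_vertices (c : {set walk2}) : {set 'S_n} :=
  [set w.1.1 | w in c].

Definition cycle_edges (c : {set walk2}) : {set 'S_n.+1} :=
  [set w.1.2 | w in c].

Definition cycles_through (u : 'S_n) : {set {set walk2}} :=
  [set c in two_cycles | u \in cycle_vertices c].

Definition cycles_on (u v : 'S_n) : {set {set walk2}} :=
  [set c in two_cycles | cycle_vertices c == [set u; v]].

Definition partners (u : 'S_n) : {set 'S_n} :=
  [set v | (v != u) && (cycles_on u v != set0)].

(* The pairs (u, v) of vertices of a common 2-cycle such that several edges go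
   from u to v. *)
Definition multi_pairs : {set 'S_n * 'S_n} :=
  [set p | (cycles_on p.1 p.2 != set0) && (1 < #|edges p.1 p.2|)].

End Graph.

(* Main.v *)
Require Import Defs.
From mathcomp Require Import all_boot all_fingroup.
From mathcomp Require Import zify.

Set Implicit Arguments.
Unset Strict Implicit.
Unset Printing Implicit Defensive.

(* Let [(u, e1, v, e2, u)] be a closed walk. Going around twice shows that the
   comparison of the letters at positions [i] and [i + d] depends only on [d] and
   on the parity of [i], in all four words at once. Transitivity then leaves few
   possibilities: either the letters at even and odd positions are monotone in
   opposite directions, one class lying above the other (two 2-cycles), or both
   classes are monotone in the same direction and interleave according to a
   threshold on the signed odd distances. With m = ceil(n/2) there are 2m + 1
   thresholds for each direction; going around by one step reflects them, and the
   fixed middle one is the monotone word, for which u = v. This gives 2m more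
   2-cycles. Two walks share a vertex only if their thresholds differ at a
   distance too long to fit in the word. *)

(** * Words as patterns of integer sequences *)

Definition word t (f : nat -> nat) : 'S_t := st (fun i : 'I_t => f i).

Definition inj_upto t (f : nat -> nat) := forall i j, i < j < t -> f i <> f j.

Section Words.

Variables (t : nat) (f : nat -> nat).
Hypothesis f_inj : inj_upto t f.

Lemma word_lt (i j : 'I_t) : (word t f i < word t f j) = (f i < f j).
Proof.
have inj : injective (fun i : 'I_t => f i).
  move=> k l eq_f; apply: val_inj; have := ltn_ord k; have := ltn_ord l.
  case: (ltngtP k l) => // lt_kl ? ?; first by have := @f_inj k l; lia.
  by have := @f_inj l k; lia.
by have /forallP/(_ i)/forallP/(_ j)/eqP := stP inj.
Qed.

Lemma wordP (s : 'S_t) :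
  (forall i j : 'I_t, i < j -> (s i < s j) = (f i < f j)) -> s = word t f.
Proof.
move=> sP; apply: (@is_st_uniq t (fun i => f i)); last first.
  by apply/forallP=> i; apply/forallP=> j; apply/eqP; apply: word_lt.
apply/forallP=> i; apply/forallP=> j; apply/eqP.
have [/sP //|lt_ji|/val_inj ->] := ltngtP i j; last by rewrite !ltnn.
have := sP _ _ lt_ji; have : s i <> s j :> nat.
  by move=> /val_inj/perm_inj eq_ij; rewrite eq_ij ltnn in lt_ji.
have := @f_inj j i; have := ltn_ord i; lia.
Qed.

Lemma word_val : (forall i, i < t -> f i < t) ->
  forall i : 'I_t, word t f i = f i :> nat.
Proof.
move=> f_lt; pose g (i : 'I_t) := Ordinal (f_lt i (ltn_ord i)).
have g_inj : injective g.
  move=> k l /(congr1 val) /= eq_f; apply: val_inj.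
  have := ltn_ord k; have := ltn_ord l.
  case: (ltngtP k l) => // lt_kl ? ?; first by have := @f_inj k l; lia.
  by have := @f_inj l k; lia.
move=> i; rewrite -(@wordP (perm g_inj)) ?permE // => j k _.
by rewrite !permE.
Qed.

End Words.

Lemma eq_word t f g : inj_upto t f -> inj_upto t g ->
  (word t f = word t g) <-> (forall i j, i < j < t -> (f i < f j) = (g i < g j)).
Proof.
move=> f_inj g_inj; split=> [eq_fg i j ij|eq_fg].
  have jt : j < t by lia.
  have it : i < t by lia.
  have := word_lt f_inj (Ordinal it) (Ordinal jt).
  by rewrite eq_fg (word_lt g_inj).
apply: wordP => // i j lt_ij; rewrite (word_lt f_inj); apply: eq_fg.
by rewrite lt_ij /=.
Qed.

Lemma eq_st t (c c' : 'I_t -> nat) : c =1 c' -> st c = st c'.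
Proof.
move=> eq_c; congr odflt; apply: eq_pick => d.
by apply: eq_forallb => i; apply: eq_forallb => j; rewrite !eq_c.
Qed.

(** * Edges as words, and their two end vertices *)

Definition pos t (e : 'S_t.+1) (i : nat) : nat := e (inord i).

Lemma pos_inj t (e : 'S_t.+1) : inj_upto t.+1 (pos e).
Proof.
move=> i j ij /val_inj/perm_inj/(congr1 val); rewrite /= !inordK; lia.
Qed.

Lemma word_pos t (e : 'S_t.+1) : word t.+1 (pos e) = e.
Proof.
apply/esym/wordP; first exact: pos_inj.
by move=> i j _; rewrite /pos !inord_val.
Qed.

Lemma edge_tailE t (e : 'S_t.+1) : edge_tail e = word t (pos e).
Proof.
apply: eq_st => i; rewrite /pos; congr (nat_of_ord (e _)); apply: val_inj.
by rewrite /= inordK // ltnW // ltnS.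
Qed.

Lemma edge_headE t (e : 'S_t.+1) : edge_head e = word t (pos e \o S).
Proof.
apply: eq_st => i; rewrite /pos; congr (nat_of_ord (e _)); apply: val_inj.
by rewrite /= inordK // ltnS.
Qed.

Lemma pos_word t f : inj_upto t.+1 f ->
  forall i j, i < t.+1 -> j < t.+1 ->
  (pos (word t.+1 f) i < pos (word t.+1 f) j) = (f i < f j).
Proof. by move=> f_inj i j it jt; rewrite /pos word_lt // !inordK. Qed.

Lemma edge_tail_word t f : inj_upto t.+1 f -> edge_tail (word t.+1 f) = word t f.
Proof.
move=> f_inj; rewrite edge_tailE; apply/eq_word.
- by move=> i j ij; apply: pos_inj; lia.
- by move=> i j ij; apply: f_inj; lia.
- by move=> i j ij; apply: pos_word => //; lia.
Qed.

Lemma edge_head_word t f : inj_upto t.+1 f ->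
  edge_head (word t.+1 f) = word t (f \o S).
Proof.
move=> f_inj; rewrite edge_headE; apply/eq_word.
- by move=> i j ij; apply: pos_inj; lia.
- by move=> i j ij; apply: f_inj; lia.
- by move=> i j ij; apply: pos_word => //; lia.
Qed.

(** * Codes and the words that realise them *)

Section Codes.

Variable n : nat.
Hypothesis n_ge4 : 4 <= n.

Local Notation m := (uphalf n).

(* A code describes a walk by the table [tab] of comparisons: [tab c p d] tells
   whether a letter at a position [i] of parity [p] is smaller than the one at
   [i + d]. With [inl k], the letters at even positions and those at odd positions
   increase, and a letter at an even position is below one at an odd position iff
   the signed distance from the former to the latter exceeds [2 * (k - m)]; for
   [k = m] the word is monotone and the two vertices coincide, which [proper_code]
   excludes. With [inr q] the two parities have opposite directions. The boolean
   in the second component reverses all comparisons. *)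
Definition code : finType := (('I_(2 * m).+1 + bool) * bool)%type.

Definition tab (c : code) (p : bool) (d : nat) : bool :=
  c.2 (+) match c.1 with
          | inl k => odd d ==> (if p then 2 * m < d + 2 * k else 2 * k < d + 2 * m)
          | inr q => ~~ p (+) (q && odd d)
          end.

(* The code of the same closed walk started at its second vertex. *)
Definition rot (c : code) : code :=
  match c with
  | (inl k, b) => (inl (rev_ord k), b)
  | (inr q, b) => (inr q, ~~ b)
  end.

Definition proper_code (c : code) : bool :=
  if c.1 is inl k then k != m :> nat else true.

(* A word of integers realising [tab c] on the positions [0, ..., n + 1]. *)
Definition model (c : code) (i : nat) : nat :=
  let w := match c.1 with
           | inl k => i + 2 * (if odd i then m else k)
           | inr q => if odd i then (if q then n.+1 else 4 * n.+1) - i else n.+2 + i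
           end in
  if c.2 then 5 * n.+2 - w else w.

(** There are no ties: in the [inl] case positions are shifted by even amounts, and in the [inr]
    case the two classes occupy disjoint ranges. *)
Lemma modelP c i j : i < j < n.+2 ->
  model c i <> model c j /\ (model c i < model c j) = tab c (odd i) (j - i).
Proof.
case: c => [[k|q] b]; rewrite /model /tab /=; first have := ltn_ord k.
  case oi: (odd i); case oj: (odd j); case: b; lia.
case oi: (odd i); case oj: (odd j); case: b; case: q; lia.
Qed.

Lemma model_inj c : inj_upto n.+2 (model c).
Proof. by move=> i j /(modelP c)[]. Qed.

(** Exchanging the parities changes the sign of the odd distances, hence reflects the threshold. *)
Lemma tab_rot c p d : tab (rot c) p d = tab c (~~ p) d.
Proof.
case: c => [[k|q] b]; rewrite /tab /=; last by case: p; case: b; case: (_ && _).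
have := ltn_ord k; move: (odd d) => od kP; case: p; case: b; case: od => //=; lia.
Qed.

Lemma rotK : involutive rot.
Proof. by case=> [[k|q] b] /=; rewrite ?rev_ordK ?negbK. Qed.

Lemma proper_rot c : proper_code (rot c) = proper_code c.
Proof.
by case: c => [[k|q] b] //; rewrite /proper_code /=; have := ltn_ord k; lia.
Qed.

(** * Closed walks correspond to proper codes *)

Definition vert (c : code) : 'S_n := word n (model c).
Definition edge (c : code) : 'S_n.+1 := word n.+1 (model c).
Definition walk_of (c : code) : walk2 n :=
  ((vert c, edge c), (vert (rot c), edge (rot c))).

Lemma model_inj_upto t c : t <= n.+2 -> inj_upto t (model c).
Proof. by move=> tn i j ij; apply: model_inj; lia. Qed.

Lemma vertP c (s : 'S_n) :
  (forall i j : 'I_n, i < j -> (s i < s j) = tab c (odd i) (j - i)) -> s = vert c.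
Proof.
move=> sP; apply: wordP => [|i j ij]; first by apply: model_inj_upto; lia.
by rewrite sP // (modelP c _).2 //; have := ltn_ord j; lia.
Qed.

(** Position [p] is the first of its parity, so every distance that occurs from that parity already
    occurs there. *)
Lemma eq_word_model t c c' : t <= n.+1 ->
  (word t (model c) = word t (model c')) <->
  (forall (p : bool) d, 0 < d -> p + d < t -> tab c p d = tab c' p d).
Proof.
move=> tn; have tn2 : t <= n.+2 by lia.
split=> [/(eq_word (model_inj_upto tn2) (model_inj_upto tn2)) eqM p d d_gt0 pd|eqT].
  have := eqM p (p + d); rewrite !(modelP _ _).2 ?oddb ?addKn; [|lia..].
  by apply; lia.
apply/eq_word; try exact: model_inj_upto.
by move=> i j ij; rewrite !(modelP _ _).2; [apply: eqT; lia|lia..].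
Qed.

Lemma edge_tail_edge c : edge_tail (edge c) = vert c.
Proof. by apply: edge_tail_word; apply: model_inj_upto. Qed.

Lemma edge_head_edge c : edge_head (edge c) = vert (rot c).
Proof.
rewrite edge_head_word; last exact: model_inj_upto.
apply/eq_word => [i j ij|i j ij|i j ij].
- by apply: model_inj; lia.
- by apply: model_inj; lia.
- by rewrite /= !(modelP _ _).2 ?tab_rot; [congr tab|..]; lia.
Qed.

(* The hypothesis on [L] is transitivity of [<] and of its negation at once. *)
Lemma table_code (L : bool -> nat -> bool) :
  (forall p d d', 0 < d -> 0 < d' -> d + d' <= n ->
     L p d = L (p (+) odd d) d' -> L p (d + d') = L p d) ->
  exists c : code, forall p d, 0 < d <= n -> L p d = tab c p d.
Proof.
move=> Ltrans.
have Leven p r : 2 * r.+1 <= n -> L p (2 * r.+1) = L p 2.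
  elim: r => // r IHr rn; rewrite mulnS.
  by apply: Ltrans; rewrite ?addbF ?IHr //; lia.
have half_eq d : d = 2 * d./2 + odd d by lia.
(* Distance 2 gives the direction of each parity class; opposite directions are treated first. *)
have [eqL|neqL] := eqVneq (L true 2) (L false 2); last first.
  have neqLp p : L (~~ p) 2 = ~~ L p 2.
    by case: p; move: neqL; case: (L true 2); case: (L false 2).
  (* Otherwise two steps of length 1 would give both classes the same direction. *)
  have neqL1 : L true 1 = ~~ L false 1.
    have := Ltrans false 1 1 isT isT; have := Ltrans true 1 1 isT isT.
    move: neqL; case: (L true 1); case: (L false 1) => //= + h1 h2;
    by rewrite h1 ?h2 //; lia.
  have Lodd p r : (2 * r).+1 <= n -> L p (2 * r).+1 = L p 1.
    case: r => // r rn.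
    (* The unit step is taken last or first, whichever makes the two comparisons agree. *)
    have [eqL1|neqLp1] := eqVneq (L p 1) (L p 2).
      rewrite -addn1 Ltrans ?Leven ?eqL1 //; try lia.
      have -> : odd (2 * r.+1) = false by lia.
      by rewrite addbF eqL1.
    rewrite -add1n Ltrans ?Leven ?addbT ?neqLp //; try lia.
  exists (inr (L false 1 (+) L false 2), ~~ L false 2) => p d /andP[d_gt0 dn].
  rewrite /tab /= (half_eq d); case od: (odd d).
    rewrite addn1 Lodd; last by lia.
    have -> : odd (2 * d./2).+1 by lia.
    case: p; rewrite ?neqL1; by case: (L false 1); case: (L false 2).
  case eq_r : d./2 => [|r]; first by lia.
  rewrite addn0 Leven; last by lia.
  have -> : odd (2 * r.+1) = false by lia.
  by case: p; rewrite ?(neqLp false); case: (L false 2); rewrite ?andbF.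
have Lall p r : 2 * r.+1 <= n -> L p (2 * r.+1) = L false 2.
  by case: p => /Leven -> .
set B := L false 2 in Lall.
(* From each parity, the odd distances switch to [B] at most once. *)
have Lmono p r i : (2 * (r + i)).+1 <= n -> L p (2 * r).+1 = B ->
    L p (2 * (r + i)).+1 = B.
  move=> rn LB; case: i rn => [|i] rn; first by rewrite addn0.
  have -> : (2 * (r + i.+1)).+1 = (2 * r).+1 + 2 * i.+1 by lia.
  by rewrite Ltrans ?LB ?Lall //; lia.
(* The place of the switch; [find] returns [m] if there is none. *)
pose s p := find (fun r => L p (2 * r).+1 == B) (iota 0 m).
have s_le p : s p <= m
    by have := find_size (fun r => L p (2 * r).+1 == B) (iota 0 m); rewrite size_iota.
have sP p r : r < m -> (L p (2 * r).+1 == B) = (s p <= r).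
  move=> rm; apply/idP/idP => [LB|s_r]; last first.
    have s_lt : s p < m by lia.
    have := nth_find 0 (_ : has (fun r => L p (2 * r).+1 == B) (iota 0 m)).
    rewrite -/(s p) has_find size_iota s_lt nth_iota // => /(_ isT)/eqP LB.
    apply/eqP; rewrite -(subnKC s_r); apply: Lmono => //; lia.
  rewrite leqNgt; apply/negP => r_lt.
  by have := before_find 0 r_lt; rewrite nth_iota // LB.
(* Two unit steps both against [B] would make distance 2 go against [B]. *)
have s0 : s false = 0 \/ s true = 0.
  have m_gt0 : 0 < m by lia.
  have := sP false 0 m_gt0; have := sP true 0 m_gt0; rewrite !leqn0 !muln0.
  have := Ltrans false 1 1 isT isT; rewrite -/B.
  case: (eqVneq (s false) 0) => [->|]; first by left.
  case: (eqVneq (s true) 0) => [->|]; first by right.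
  case: (L true 1); case: (L false 1); case: (B) => //= _ _ h; rewrite h //; lia.
(* Since one of the two vanishes, the difference [s false - s true] determines both; adding [m]
   makes it a natural number. *)
have k_lt : m + s false - s true < (2 * m).+1 by have := s_le false; lia.
exists (inl (Ordinal k_lt), ~~ B) => p d /andP[d_gt0 dn].
rewrite /tab /= (half_eq d); case od: (odd d).
  rewrite addn1; have rm : d./2 < m by lia.
  have -> : odd (2 * d./2).+1 by lia.
  have := sP p _ rm; have := s_le false; have := s_le true.
  case: p; case: (L _ _); case: (B) => //=; lia.
case eq_r : d./2 => [|r]; first by lia.
rewrite addn0 Lall; last by lia.
have -> : odd (2 * r.+1) = false by lia.
by case: (B).
Qed.

Lemma closed_walk_of c : proper_code c -> closed_walk2 (walk_of c).
Proof.
move=> c_ok; rewrite /walk_of /= !inE !edge_tail_edge !edge_head_edge rotK !eqxx.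
rewrite !andbT; apply/eqP => /eq_word_model eqT.
(* Distance 1 separates a threshold other than [m] from its reflection, distance 2 the two words of
   an [inr] code. *)
have := eqT (leqnSn n) false 1; have := eqT (leqnSn n) false 2.
rewrite !tab_rot; case: c c_ok {eqT} => [[k|q] b]; rewrite /proper_code /tab /=.
  case: b; lia.
case: q; case: b; lia.
Qed.

Lemma closed_walkP w : closed_walk2 w -> exists2 c, proper_code c & w = walk_of c.
Proof.
case: w => [[u e1] [v e2]] /= /and3P[uv]; rewrite !inE => /andP[/eqP tl1 /eqP hd1].
move=> /andP[/eqP tl2 /eqP hd2].
pose F (p : bool) := pos (if p then e2 else e1).
have F_inj p : inj_upto n.+1 (F p) by apply: pos_inj.
(* The tail of each edge is the head of the other. *)
have Fshift p i d : i + d < n ->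
    (F p i < F p (i + d)) = (F (~~ p) i.+1 < F (~~ p) (i + d).+1).
  case: d => [|d] idn; first by rewrite addn0 !ltnn.
  have /eq_word : word n (F p) = word n (F (~~ p) \o S).
    by case: p; rewrite -edge_tailE -edge_headE /= ?tl1 ?tl2.
  apply=> [j k jk|j k jk|]; [apply: F_inj|apply: F_inj|]; lia.
pose L p d := F p 0 < F p d.
(* Moving back to position 0 switches edges [i] times, so only the parity of [i] survives. *)
have FL i d p : i + d <= n -> (F p i < F p (i + d)) = L (p (+) odd i) d.
  elim: i p => [|i IHi] p idn; first by rewrite addbF.
  by rewrite addSn -[p]negbK -Fshift // IHi 1?ltnW //= addbN negbK addNb.
have [p d d' d_gt0 d'_gt0 ddn|c cP] := @table_code L.
  rewrite -FL // /L; have := F_inj p 0 d; have := F_inj p d (d + d').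
  have := F_inj p 0 (d + d'); lia.
have FT p i j : i < j < n.+1 -> (F p i < F p j) = tab c (p (+) odd i) (j - i).
  by move=> ij; rewrite -cP ?FL ?subnKC //; try lia; rewrite -FL ?subnKC //; lia.
have e1E : e1 = edge c.
  rewrite -(word_pos e1); apply/eq_word; first exact: (F_inj false).
    exact: model_inj_upto.
  by move=> i j ij; rewrite (FT false) // (modelP _ _).2 //; lia.
have e2E : e2 = edge (rot c).
  rewrite -(word_pos e2); apply/eq_word; first exact: (F_inj true).
    exact: model_inj_upto.
  by move=> i j ij; rewrite (FT true) // (modelP _ _).2 ?tab_rot //; lia.
have uE : u = vert c by rewrite -tl1 e1E edge_tail_edge.
have vE : v = vert (rot c) by rewrite -tl2 e2E edge_tail_edge.
exists c; last by rewrite uE vE e1E e2E.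
(* At [k = m] the code is its own rotation, which would give [u = v]. *)
move: uv; rewrite uE vE; case: c {cP FT e1E e2E uE vE} => [[k|q] b] //.
rewrite /proper_code /=; apply: contra => /eqP km; apply/eqP.
congr (vert (inl _, b)); apply: val_inj; rewrite /= km; lia.
Qed.

(** * Codes with a common vertex or edge *)

Definition same_vert (c c' : code) : bool :=
  match c, c' with
  | (inl k, b), (inl k', b') =>
    (b == b') && [|| k == k' :> nat, (k <= 1) && (k' <= 1)
                   | [&& odd n, 2 * m - 1 <= k & 2 * m - 1 <= k']]
  | (inr q, b), (inr q', b') => (b == b') && (q == q')
  | _, _ => false
  end.

Definition same_edge (c c' : code) : bool :=
  match c, c' with
  | (inl k, b), (inl k', b') =>
    (b == b') && ((k == k' :> nat) || [&& odd n, k <= 1 & k' <= 1])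
  | (inr q, b), (inr q', b') => (b == b') && (q == q')
  | _, _ => false
  end.

(* The letters of two monotone codes [k < k'] compare differently exactly at the
   positions whose (signed, odd) distance lies between the thresholds
   [2 * (k - m)] and [2 * (k' - m)]. *)
Lemma eq_word_codes t c c' : n <= t <= n.+1 ->
  word t (model c) = word t (model c') ->
  match c, c' with
  | (inl k, b), (inl k', b') =>
    b = b' /\ forall j, k <= j < k' ->
      (m <= j -> t <= 2 * (j - m) + 1) /\ (j < m -> t <= 2 * (m - j))
  | (inr q, b), (inr q', b') => b = b' /\ q = q'
  | _, _ => False
  end.
Proof.
move=> /andP[nt tn] /eq_word_model -/(_ tn) eqT.
have T01 := eqT false 1 isT; have T02 := eqT false 2 isT.
have T12 := eqT true 2 isT.
case: c c' eqT T01 T02 T12 => [[k|q] b] [[k'|q'] b'] eqT;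
  rewrite /tab /= => T01 T02 T12; last first.
- by case: b b' q q' {eqT} T01 T02 T12 => -[] [] []; lia.
- by case: b b' q {eqT} T01 T02 T12 => -[] []; lia.
- by case: b b' q' {eqT} T01 T02 T12 => -[] []; lia.
have bE : b = b' by case: b b' {eqT} T01 T02 T12 => -[]; lia.
split=> // j kj; split=> jm; rewrite leqNgt; apply/negP => jt.
  have := eqT false (2 * (j - m) + 1); rewrite /tab /= bE.
  have -> : odd (2 * (j - m) + 1) by lia.
  by case: (b'); lia.
have := eqT true (2 * (m - j) - 1); rewrite /tab /= bE.
have -> : odd (2 * (m - j) - 1) by lia.
by case: (b'); lia.
Qed.

(** If [k < m], then [j = k] forces [k = 0] because [2 * m - 1 <= n <= t], and [j = 1] then excludes
    [k' >= 2]. *)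
Lemma visible_thresholds t k k' : n <= t <= n.+1 -> k < k' -> k' < (2 * m).+1 ->
  (forall j, k <= j < k' ->
     (m <= j -> t <= 2 * (j - m) + 1) /\ (j < m -> t <= 2 * (m - j))) ->
  (m <= k /\ t <= 2 * (k - m) + 1) \/ [/\ t <= 2 * m, k = 0 & k' = 1].
Proof.
move=> tn lt_kk' k'm far; have [km|km] := leqP m k.
  by left; split=> //; apply: (far k _).1; lia.
right.
have kt : t <= 2 * (m - k) by apply: (far k _).2; lia.
have [k'1|k'1] := leqP k' 1; first by split; lia.
by have := (far 1 _).2; lia.
Qed.

(** Thresholds 0 and 1 differ only at distance [2 * m - 1] from an odd position, which ends beyond
    position [n - 1]. Thresholds [2 * m - 1] and [2 * m] differ only at that distance from an even
    position, which fits iff [n] is even. *)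
Lemma same_vertP c c' : reflect (vert c = vert c') (same_vert c c').
Proof.
apply: (iffP idP) => [|eq_cc'].
  case: c c' => [[k|q] b] [[k'|q'] b'] //=; last by move=> /andP[/eqP-> /eqP->].
  move=> /andP[/eqP-> kk']; apply/eq_word_model => // p d d_gt0 pd.
  have := ltn_ord k; have := ltn_ord k'; rewrite /tab /=.
  by case: p pd; case od: (odd d); case: (b') => //=; lia.
have n2 : n <= n <= n.+1 by lia.
have := eq_word_codes n2 eq_cc'; have := eq_word_codes n2 (esym eq_cc').
case: c c' {eq_cc'} => [[k|q] b] [[k'|q'] b'] //=; last first.
  by move=> _ [-> ->]; rewrite !eqxx.
move=> [_ h1] [-> h2]; rewrite eqxx /=.
have [lt_kk'|lt_kk'|->] := ltngtP k k'; last by [].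
  by have := ltn_ord k';
    have [|[]] := @visible_thresholds n _ _ n2 lt_kk' (ltn_ord k') h2; lia.
by have := ltn_ord k;
    have [|[]] := @visible_thresholds n _ _ n2 lt_kk' (ltn_ord k) h1; lia.
Qed.

(** With one more letter the top two thresholds are always separated, and 0 and 1 are separated iff
    [n] is even. *)
Lemma same_edgeP c c' : reflect (edge c = edge c') (same_edge c c').
Proof.
apply: (iffP idP) => [|eq_cc'].
  case: c c' => [[k|q] b] [[k'|q'] b'] //=; last by move=> /andP[/eqP-> /eqP->].
  move=> /andP[/eqP-> kk']; apply/eq_word_model => // p d d_gt0 pd.
  have := ltn_ord k; have := ltn_ord k'; rewrite /tab /=.
  by case: p pd; case od: (odd d); case: (b') => //=; lia.
have n2 : n <= n.+1 <= n.+1 by lia.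
have := eq_word_codes n2 eq_cc'; have := eq_word_codes n2 (esym eq_cc').
case: c c' {eq_cc'} => [[k|q] b] [[k'|q'] b'] //=; last first.
  by move=> _ [-> ->]; rewrite !eqxx.
move=> [_ h1] [-> h2]; rewrite eqxx /=.
have [lt_kk'|lt_kk'|->] := ltngtP k k'; last by [].
  by have := ltn_ord k';
    have [|[]] := @visible_thresholds n.+1 _ _ n2 lt_kk' (ltn_ord k') h2; lia.
by have := ltn_ord k;
    have [|[]] := @visible_thresholds n.+1 _ _ n2 lt_kk' (ltn_ord k) h1; lia.
Qed.

(** * Complements and numeric thresholds *)

Lemma vert_compl x b : compl (vert (x, b)) = vert (x, ~~ b).
Proof.
apply: vertP => i j ij; rewrite /compl !permM !permE /=.
have aP : (vert (x, b) i < vert (x, b) j) = tab (x, b) (odd i) (j - i).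
  rewrite word_lt; last by apply: model_inj_upto; lia.
  by rewrite (modelP _ _).2 //; have := ltn_ord j; lia.
have -> : tab (x, ~~ b) (odd i) (j - i) = ~~ tab (x, b) (odd i) (j - i).
  by rewrite /tab /= addNb.
rewrite -aP; have : vert (x, b) i <> vert (x, b) j :> nat.
  by move=> /val_inj/perm_inj eq_ij; rewrite eq_ij ltnn in ij.
move: (ltn_ord (vert (x, b) i)) (ltn_ord (vert (x, b) j)); clear.
by move: (nat_of_ord _) (nat_of_ord _) => k l; lia.
Qed.

(** Meaningful for [k <= 2 * m] only: [inord] sends larger values to 0. *)
Definition mono (k : nat) (b : bool) : code := (inl (inord k), b).

Lemma val_mono k : k <= 2 * m -> nat_of_ord (inord k : 'I_(2 * m).+1) = k.
Proof. by move=> km; rewrite inordK. Qed.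

Lemma vert_eq c c' : (vert c == vert c') = same_vert c c'.
Proof. exact/eqP/same_vertP. Qed.

Lemma edge_eq c c' : (edge c == edge c') = same_edge c c'.
Proof. exact/eqP/same_edgeP. Qed.

Lemma eq_inl k k' b b' :
  (((inl k, b) : code) == (inl k', b')) = (k == k' :> nat) && (b == b').
Proof. by []. Qed.

Lemma eq_monoE k b j b' : j <= 2 * m ->
  (((inl k, b) : code) == mono j b') = (k == j :> nat) && (b == b').
Proof. by move=> jm; rewrite eq_inl val_mono. Qed.

Lemma mono_eq j j' b b' : j <= 2 * m -> j' <= 2 * m ->
  (mono j b == mono j' b') = (j == j') && (b == b').
Proof. by move=> jm jm'; rewrite eq_monoE // val_mono. Qed.

Lemma rot_mono j b : j <= 2 * m -> rot (mono j b) = mono (2 * m - j) b.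
Proof. by move=> jm; apply/eqP; rewrite eq_monoE ?eqxx /= ?inordK; lia. Qed.

Lemma proper_mono j b : j <= 2 * m -> proper_code (mono j b) = (j != m).
Proof. by move=> jm; rewrite /proper_code /= inordK. Qed.

(** * Counting the 2-cycles *)

Lemma walk_of_inj : injective walk_of.
Proof.
move=> c c' [_ eq_e _ eq_re]; apply/eqP.
(* Both edges matter: for odd [n] thresholds 0 and 1 share an edge, but their reflections do not. *)
move/same_edgeP: eq_e; move/same_edgeP: eq_re.
case: c c' => [[k|q] b] [[k'|q'] b'] //=.
  have := ltn_ord k; have := ltn_ord k'; rewrite eq_inl.
  by case: (b == b'); rewrite ?andbF //=; lia.
by move=> _ /andP[/eqP-> /eqP->].
Qed.

Lemma rotate_walk_of c : rotate (walk_of c) = walk_of (rot c).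
Proof. by rewrite /walk_of rotK. Qed.

Definition cyc (c : code) : {set walk2 n} := [set walk_of c; rotate (walk_of c)].

Lemma cyc_rot c : cyc (rot c) = cyc c.
Proof. by rewrite /cyc !rotate_walk_of rotK setUC. Qed.

Lemma cyc_inj c c' : cyc c = cyc c' -> c = c' \/ c = rot c'.
Proof.
rewrite /cyc !rotate_walk_of => eqC; have : walk_of c \in cyc c by rewrite !inE eqxx.
by rewrite /cyc !rotate_walk_of eqC !inE => /orP[] /eqP/walk_of_inj; [left|right].
Qed.

Lemma two_cyclesE : two_cycles n = cyc @: [set c | proper_code c].
Proof.
apply/setP=> C; apply/imsetP/imsetP=> [] [x].
  by move=> /closed_walkP[c c_ok ->] ->; exists c; rewrite ?inE.
by rewrite inE => c_ok ->; exists (walk_of x) => //; apply: closed_walk_of.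
Qed.

(** Representatives of the proper codes modulo [rot]. The boolean is the direction for a threshold
    below [m], and [q] for [None]. *)
Definition half_code (x : option 'I_m * bool) : code :=
  if x.1 is Some k then mono k x.2 else (inr x.2, false).

Lemma half_code_cover c : proper_code c ->
  exists x, c = half_code x \/ rot c = half_code x.
Proof.
case: c => [[k|q] b]; last first.
  by move=> _; exists (None, q); case: b; [right|left].
rewrite /proper_code [_.1]/= => km; have k2 := ltn_ord k.
have [lt_km|le_mk] := ltnP k m.
  by exists (Some (Ordinal lt_km), b); left; apply/eqP;
    rewrite eq_monoE //= ?eqxx //; lia.
have lt_rm : rev_ord k < m by rewrite /=; lia.
by exists (Some (Ordinal lt_rm), b); right; apply/eqP;
  rewrite eq_monoE //= ?eqxx //; lia.
Qed.

Lemma card_two_cycles : #|two_cycles n| = m.+1 * 2.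
Proof.
have half_inj : injective (cyc \o half_code).
  have mk (k : 'I_m) : k <= 2 * m by have := ltn_ord k; lia.
  have halfS k b : half_code (Some k, b) = mono k b by [].
  move=> [[k|] b] [[k'|] b'] /cyc_inj; rewrite ?halfS ?rot_mono //.
  - case=> /eqP; rewrite mono_eq //; try lia.
      by move=> /andP[/eqP/val_inj-> /eqP->].
    by have := ltn_ord k; have := ltn_ord k'; lia.
  - by case.
  - by case.
  - by case=> -[->].
have <- : #|{: option 'I_m * bool}| = m.+1 * 2.
  by rewrite card_prod card_option card_ord card_bool.
rewrite -(card_imset _ half_inj).
apply: eq_card => C; rewrite two_cyclesE; apply/imsetP/imsetP=> [[c]|[x _ ->]].
  rewrite inE => /half_code_cover[x [cx|cx]] ->; exists x => //=; rewrite -cx //.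
  by rewrite cyc_rot.
exists (half_code x); rewrite // inE; case: x => -[k|] b //.
by rewrite proper_mono; have := ltn_ord k; lia.
Qed.

(** * 2-cycles and edges at given vertices *)

Lemma cycle_vertices_cyc c : cycle_vertices (cyc c) = [set vert c; vert (rot c)].
Proof. by rewrite /cycle_vertices /cyc imsetU1 imset_set1. Qed.

Lemma cycle_edges_cyc c : cycle_edges (cyc c) = [set edge c; edge (rot c)].
Proof. by rewrite /cycle_edges /cyc imsetU1 imset_set1. Qed.

Lemma vert_rot_neq c : proper_code c -> vert c != vert (rot c).
Proof. by move=> /closed_walk_of /= /and3P[]. Qed.

Lemma cyc_two_cycle c : proper_code c -> cyc c \in two_cycles n.
Proof. by move=> c_ok; rewrite two_cyclesE imset_f ?inE. Qed.

Lemma cycles_throughE u :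
  cycles_through u = cyc @: [set c | proper_code c & vert c == u].
Proof.
apply/setP=> C; rewrite inE; apply/andP/imsetP => [[]|[c]].
  rewrite two_cyclesE => /imsetP[c]; rewrite inE => c_ok ->.
  rewrite cycle_vertices_cyc !inE => /orP[] /eqP->.
    by exists c; rewrite // inE c_ok /=.
  by exists (rot c); rewrite ?cyc_rot // inE proper_rot c_ok /=.
rewrite inE => /andP[c_ok /eqP <-] ->; split; first exact: cyc_two_cycle.
by rewrite cycle_vertices_cyc !inE eqxx.
Qed.

Lemma eq_set2 (T : finType) (x y u v : T) : x != y ->
  [set x; y] = [set u; v] -> (u = x /\ v = y) \/ (u = y /\ v = x).
Proof.
move=> xy eqS; have: y \in [set u; v] by rewrite -eqS !inE eqxx orbT.
have: x \in [set u; v] by rewrite -eqS !inE eqxx.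
rewrite !inE => /orP[] /eqP xE /orP[] /eqP yE; subst x y; rewrite ?eqxx in xy => //.
  by left.
by right.
Qed.

Lemma cycles_onP u v C : reflect
  (exists c, [/\ proper_code c, u = vert c, v = vert (rot c) & C = cyc c])
  (C \in cycles_on u v).
Proof.
apply: (iffP idP) => [|[c [c_ok -> -> ->]]]; last first.
  by rewrite inE cyc_two_cycle // cycle_vertices_cyc eqxx.
rewrite inE two_cyclesE => /andP[/imsetP[c]]; rewrite inE => c_ok ->.
rewrite cycle_vertices_cyc => /eqP/(eq_set2 (vert_rot_neq c_ok))[] [-> ->].
  by exists c.
by exists (rot c); rewrite proper_rot rotK cyc_rot.
Qed.

(** These codes govern both the 2-cycles on a pair of vertices and the parallel edges between
    them. *)
Definition twins c : {set code} :=
  [set c' | (vert c' == vert c) && (vert (rot c') == vert (rot c))].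

Lemma twins_proper c c' : proper_code c -> c' \in twins c -> proper_code c'.
Proof.
move=> /vert_rot_neq; rewrite inE => neq /andP[/eqP eq1 /eqP eq2].
move: neq; rewrite -eq1 -eq2; case: c' {eq1 eq2} => [[k|q] b] //.
rewrite /proper_code /=; apply: contra => /eqP km.
by rewrite vert_eq /= eqxx km; lia.
Qed.

Lemma cycles_on_vert c : proper_code c ->
  cycles_on (vert c) (vert (rot c)) = cyc @: twins c.
Proof.
move=> c_ok; apply/setP=> C; apply/cycles_onP/imsetP => [[c' [c'_ok eq1 eq2 ->]]|].
  by exists c'; rewrite // inE eq1 eq2 !eqxx.
case=> c' c'T ->; exists c'; split=> //; first exact: twins_proper c'T.
  by move: c'T; rewrite inE => /andP[/eqP].
by move: c'T; rewrite inE => /andP[_ /eqP].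
Qed.

(** A parallel edge closes up with [edge (rot c)] to a closed walk, whose code is a twin of [c]. *)
Lemma edges_vert c : proper_code c ->
  edges (vert c) (vert (rot c)) = edge @: twins c.
Proof.
move=> c_ok; apply/setP=> e; apply/idP/imsetP => [eP|[c' c'T ->]]; last first.
  by rewrite inE edge_tail_edge edge_head_edge; move: c'T; rewrite inE.
have : closed_walk2 ((vert c, e), (vert (rot c), edge (rot c))).
  have := closed_walk_of c_ok; rewrite /= => /and3P[-> _ ->]; rewrite andbT //=.
case/closed_walkP=> c' _ [eq1 -> eq2 _].
by exists c'; rewrite // inE eq1 eq2 !eqxx.
Qed.

Lemma card_cyc2 c c' : c != c' -> c != rot c' -> #|cyc @: [set c; c']| = 2.
Proof.
move=> neq neq_rot; rewrite imsetU1 imset_set1 cards2.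
by case: eqP => // /cyc_inj[] /eqP; rewrite ?(negPf neq) ?(negPf neq_rot).
Qed.

Lemma mono_neq_compl j b x : (vert (mono j b) == vert (mono x (~~ b))) = false.
Proof. by rewrite vert_eq /=; case: b. Qed.

(** * Letters of the words with extreme thresholds *)

Lemma letterE (u : 'S_n) (i : 'I_n) : letter u i.+1 = (u i).+1.
Proof.
by rewrite /letter (nth_map i) ?size_enum_ord ?ltn_ord // nth_ord_enum.
Qed.

(** Threshold 0: every even position, counted from 0, lies below every odd one. Threshold [2 * m]
    gives the opposite, [high_evens]. *)
Definition low_evens i := if odd i then m + i./2 else i./2.

Definition high_evens i := if odd i then i./2 else n./2 + i./2.

Lemma low_evensE (i : 'I_n) : vert (mono 0 false) i = low_evens i :> nat.
Proof.
have inj : inj_upto n low_evens.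
  by move=> j k jk; rewrite /low_evens; case oj: (odd j); case ok: (odd k); lia.
have -> : vert (mono 0 false) = word n low_evens.
  apply/esym/vertP => j k jk; have := ltn_ord k; rewrite word_lt //
     /low_evens /tab /= inordK //.
  by case oj: (odd j); case ok: (odd k); case od: (odd (k - j)) => //=; lia.
apply: word_val => // j jn; rewrite /low_evens; case oj: (odd j); lia.
Qed.

Lemma high_evensE (i : 'I_n) : vert (mono (2 * m) false) i = high_evens i :> nat.
Proof.
have inj : inj_upto n high_evens.
  by move=> j k jk; rewrite /high_evens; case oj: (odd j); case ok: (odd k); lia.
have -> : vert (mono (2 * m) false) = word n high_evens.
  apply/esym/vertP => j k jk; have := ltn_ord k; rewrite word_lt //
     /high_evens /tab /= inordK //.
  by case oj: (odd j); case ok: (odd k); case od: (odd (k - j)) => //=; lia.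
apply: word_val => // j jn; rewrite /high_evens; case oj: (odd j); lia.
Qed.

Lemma letter_low i : 0 < i ->
  (2 * i - 1 <= n -> letter (vert (mono 0 false)) (2 * i - 1) = i) /\
  (2 * i <= n -> letter (vert (mono 0 false)) (2 * i) = m + i).
Proof.
case: i => // i _; split=> i_n.
  have lt_i : 2 * i < n by lia.
  have -> : 2 * i.+1 - 1 = (Ordinal lt_i).+1 by rewrite /=; lia.
  rewrite letterE low_evensE /low_evens /=; case: ifP; lia.
have lt_i : (2 * i).+1 < n by lia.
have -> : 2 * i.+1 = (Ordinal lt_i).+1 by rewrite /=; lia.
rewrite letterE low_evensE /low_evens /=; case: ifP; lia.
Qed.

Lemma letter_high i : 0 < i ->
  (2 * i - 1 <= n -> letter (vert (mono (2 * m) false)) (2 * i - 1) = n./2 + i) /\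
  (2 * i <= n -> letter (vert (mono (2 * m) false)) (2 * i) = i).
Proof.
case: i => // i _; split=> i_n.
  have lt_i : 2 * i < n by lia.
  have -> : 2 * i.+1 - 1 = (Ordinal lt_i).+1 by rewrite /=; lia.
  rewrite letterE high_evensE /high_evens /=; case: ifP; lia.
have lt_i : (2 * i).+1 < n by lia.
have -> : 2 * i.+1 = (Ordinal lt_i).+1 by rewrite /=; lia.
rewrite letterE high_evensE /high_evens /=; case: ifP; lia.
Qed.

(** The first letter, the smallest of the upper class, moves to the end, an even position, and
    becomes the largest of the lower class. *)
Lemma cshift_high b : odd n ->
  cshift (vert (mono (2 * m) b)) = vert (mono 0 b).
Proof.
move=> n_odd.
have shift : cshift (vert (mono (2 * m) false)) = vert (mono 0 false).
  apply/permP=> i; apply: val_inj; rewrite /cshift permM permE.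
  rewrite [LHS]high_evensE [RHS]low_evensE /high_evens /low_evens /=.
  have := ltn_ord i; have [i_n|ni] := eqVneq i.+1 n.
    by rewrite i_n modnn /=; case oi: (odd i) => _; lia.
  by move=> lt_in; rewrite modn_small /=; case oi: (odd i) => /=; lia.
have complE j : vert (mono j true) = compl (vert (mono j false)).
  by rewrite vert_compl.
by case: b => //; rewrite !complE -shift /cshift /compl mulgA.
Qed.

(** * Even length *)

Section Even.

Hypothesis n_even : ~~ odd n.

(** Only thresholds 0 and 1 share a vertex, and their reflections [2 * m] and [2 * m - 1] do not. *)
Lemma even_twins c c' : c' \in twins c -> c' = c.
Proof.
rewrite inE !vert_eq => eqs; apply/eqP; move: eqs.
case: c c' => [[k|q] b] [[k'|q'] b'] //=.
  have := ltn_ord k; have := ltn_ord k'; rewrite eq_inl.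
  by case: (b' == b); rewrite ?andbF //=; lia.
by move=> /andP[/andP[/eqP-> /eqP->]].
Qed.

Lemma even_edges_uniq c e e' : c \in two_cycles n -> e \in cycle_edges c ->
  edge_tail e' = edge_tail e -> edge_head e' = edge_head e -> e' = e.
Proof.
rewrite two_cyclesE => /imsetP[c0]; rewrite inE => c0_ok ->.
rewrite cycle_edges_cyc => eP tl hd.
have [c1 c1_ok e_c1] : exists2 c1, proper_code c1 & e = edge c1.
  by move: eP; rewrite !inE => /orP[] /eqP ->;
    [exists c0|exists (rot c0); rewrite ?proper_rot].
have : e' \in edges (vert c1) (vert (rot c1)).
  by rewrite inE tl hd e_c1 edge_tail_edge edge_head_edge !eqxx.
by rewrite edges_vert // => /imsetP[c' /even_twins -> ->].
Qed.

Lemma even_vertices_uniq c c' : c \in two_cycles n -> c' \in two_cycles n ->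
  cycle_vertices c = cycle_vertices c' -> c = c'.
Proof.
rewrite two_cyclesE => /imsetP[x]; rewrite inE => x_ok ->.
move=> /imsetP[y]; rewrite inE => y_ok ->.
rewrite !cycle_vertices_cyc => /(eq_set2 (vert_rot_neq x_ok))[] [eq1 eq2].
  by rewrite (@even_twins x y) // inE eq1 eq2 !eqxx.
by rewrite -(cyc_rot x) (@even_twins (rot x) y) // inE rotK eq1 eq2 !eqxx.
Qed.

Lemma even_card_through b : #|cycles_through (vert (mono 0 b))| = 2.
Proof.
rewrite cycles_throughE.
have -> : [set c | proper_code c & vert c == vert (mono 0 b)] =
    [set mono 0 b; mono 1 b].
  apply/setP=> c; rewrite !inE vert_eq; case: c => [[k|q] b'] //.
  rewrite !eq_monoE //; try lia; rewrite /proper_code /= inordK //.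
  by have := ltn_ord k; case: (b' == b); rewrite ?andbF ?andbT //=; lia.
by rewrite card_cyc2 ?rot_mono ?mono_eq //; lia.
Qed.

Lemma even_card_through1 (u : 'S_n) : cycles_through u <> set0 ->
  (forall b, u <> vert (mono 0 b)) -> #|cycles_through u| = 1.
Proof.
rewrite cycles_throughE => /eqP/set0Pn[C /imsetP[c]]; rewrite inE.
move=> /andP[c_ok /eqP <-] _ nu.
have -> : [set c' | proper_code c' & vert c' == vert c] = [set c].
  apply/setP=> c'; rewrite !inE; apply/andP/eqP => [[_]|->]; last by rewrite eqxx.
  rewrite vert_eq => eqs; apply/eqP; move: eqs.
  case: c {c_ok} nu c' => [[k|q] b] nu [[k'|q'] b'] //=; last first.
    by move=> /andP[/eqP-> /eqP->].
  (* Thresholds 0 and 1 both give the excluded vertex. *)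
  have k_gt1 : 1 < k.
    rewrite ltnNge; apply/negP => k1; case: (nu b); apply/eqP.
    by rewrite vert_eq /= eqxx inordK // k1 orbT.
  have := ltn_ord k; have := ltn_ord k'; rewrite eq_inl.
  by case: (b' == b); rewrite ?andbF //=; lia.
by rewrite imset_set1 cards1.
Qed.

End Even.

(** * Odd length *)

Section Odd.

Hypothesis n_odd : odd n.

(** Reflection exchanges the coinciding pairs at the bottom and at the top, so the first vertex
    determines the second. *)
Lemma odd_twins c c' : (c' \in twins c) = same_vert c' c.
Proof.
rewrite inE !vert_eq; case: c c' => [[k|q] b] [[k'|q'] b'] //=.
  have := ltn_ord k; have := ltn_ord k'.
  by case: (b' == b); rewrite ?andbF //=; lia.
by case: b; case: b'; case: (q' == q).
Qed.

Lemma odd_card_partners (u : 'S_n) : cycles_through u <> set0 -> #|partners u| = 1.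
Proof.
rewrite cycles_throughE => /eqP/set0Pn[C /imsetP[c]]; rewrite inE.
move=> /andP[c_ok /eqP <-] _.
have -> : partners (vert c) = [set vert (rot c)]; last exact: cards1.
apply/setP=> v; rewrite !inE; apply/andP/eqP => [[_]|->].
  case/set0Pn=> C' /cycles_onP[c' [_ /eqP eq_v -> _]]; apply/eqP.
  have : c' \in twins c by rewrite odd_twins -vert_eq eq_sym.
  by rewrite inE => /andP[].
rewrite eq_sym vert_rot_neq //; split=> //; apply/set0Pn; exists (cyc c).
by apply/cycles_onP; exists c.
Qed.

Lemma twins_high b : twins (mono (2 * m) b) = [set mono (2 * m) b; mono (2 * m - 1) b].
Proof.
apply/setP=> c; rewrite odd_twins !inE; case: c => [[k|q] b'] //.
rewrite !eq_monoE //; try lia; rewrite /= inordK //.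
by have := ltn_ord k; case: (b' == b); rewrite ?andbF ?andbT //=; lia.
Qed.

Lemma rot_high b : rot (mono (2 * m) b) = mono 0 b.
Proof. by rewrite rot_mono // subnn. Qed.

Lemma proper_high b : proper_code (mono (2 * m) b).
Proof. by rewrite proper_mono //; lia. Qed.

(** The top two thresholds differ only at distance [2 * m - 1 = n], which fits in an edge but not in
    a vertex. *)
Lemma card_edges_high b : #|edges (vert (mono (2 * m) b)) (vert (mono 0 b))| = 2.
Proof.
rewrite -rot_high edges_vert ?proper_high // twins_high imsetU1 imset_set1 cards2.
by rewrite edge_eq /= eqxx !inordK //; lia.
Qed.

Lemma card_cycles_on_high b : #|cycles_on (vert (mono (2 * m) b)) (vert (mono 0 b))| = 2.
Proof.
rewrite -rot_high cycles_on_vert ?proper_high // twins_high card_cyc2 //.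
  by rewrite mono_eq //; lia.
by rewrite rot_mono ?mono_eq //; lia.
Qed.

Lemma odd_multi_pairs : multi_pairs n =
  [set (vert (mono (2 * m) false), vert (mono 0 false));
       (vert (mono (2 * m) true), vert (mono 0 true))].
Proof.
apply/setP=> -[u v]; rewrite [in LHS]inE; apply/andP/idP => /= [[]|].
  case/set0Pn=> C /cycles_onP[c [c_ok -> -> _]] {C u v}.
  rewrite edges_vert // => /card_gt1P[e1 [e2 [/imsetP[c1 c1T ->] /imsetP[c2 c2T ->]]]].
  rewrite edge_eq => neq; rewrite !odd_twins in c1T c2T.
  (* Thresholds 0 and 1 share even their edge, so distinct parallel edges come only from the top
     pair. *)
  have [b cT] : exists b, c \in twins (mono (2 * m) b).
    case: c {c_ok} c1T c2T => [[k|q] b]; exists b; last first.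
      case: c1 c2 neq c1T c2T => [[k1|q1] b1] [[k2|q2] b2] //=.
      move=> neq /andP[/eqP b1E /eqP q1E] /andP[/eqP b2E /eqP q2E].
      by rewrite b1E q1E b2E q2E !eqxx in neq.
    rewrite odd_twins /= eqxx inordK //.
    case: c1 c2 neq c1T c2T => [[k1|q1] b1] [[k2|q2] b2] //=.
    have := ltn_ord k; have := ltn_ord k1; have := ltn_ord k2.
    move=> k2m k1m km neq /andP[/eqP b1E c1T] /andP[/eqP b2E c2T].
    by rewrite b1E b2E eqxx /= in neq; lia.
  move: cT; rewrite inE rot_high => /andP[/eqP-> /eqP->].
  by case: b; rewrite !inE !xpair_eqE !eqxx ?orbT.
have highP b : cycles_on (vert (mono (2 * m) b)) (vert (mono 0 b)) != set0
    /\ 1 < #|edges (vert (mono (2 * m) b)) (vert (mono 0 b))|.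
  by rewrite card_edges_high -card_gt0 card_cycles_on_high.
by rewrite !inE => /orP[] /eqP[-> ->].
Qed.

End Odd.

End Codes.

Theorem theorem4p2 (n : nat) (n_ge4 : 4 <= n) :
  [/\ #|two_cycles n| = (if odd n then n + 3 else n + 2),
      ~~ odd n ->
        [/\ (forall c e e', c \in two_cycles n -> e \in cycle_edges c ->
               edge_tail e' = edge_tail e -> edge_head e' = edge_head e -> e' = e),
            (forall c c', c \in two_cycles n -> c' \in two_cycles n ->
               cycle_vertices c = cycle_vertices c' -> c = c')
          & exists a : 'S_n,
              [/\ (forall i, 1 <= i <= n./2 ->
                     letter a (2 * i - 1) = i /\ letter a (2 * i) = n./2 + i),
                  a <> compl a,
                  #|cycles_through a| = 2,
                  #|cycles_through (compl a)| = 2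
                & forall u : 'S_n, cycles_through u <> set0 ->
                    u <> a -> u <> compl a -> #|cycles_through u| = 1]]
    & odd n ->
        [/\ (forall u : 'S_n, cycles_through u <> set0 -> #|partners u| = 1)
          & exists a : 'S_n,
              [/\ (forall i, 1 <= i <= (n + 1)./2 ->
                     letter a (2 * i - 1) = (n - 1)./2 + i) /\
                  (forall i, 1 <= i <= (n - 1)./2 -> letter a (2 * i) = i),
                  [set a; cshift a] <> [set compl a; cshift (compl a)],
                  multi_pairs n =
                    [set (a, cshift a); (compl a, cshift (compl a))],
                  #|edges a (cshift a)| = 2 /\
                  #|edges (compl a) (cshift (compl a))| = 2
                & #|cycles_on a (cshift a)| = 2 /\
                  #|cycles_on (compl a) (cshift (compl a))| = 2]]].
Proof.
split.
- by rewrite card_two_cycles //; case: ifP; lia.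
- move=> n_even; split.
  + exact: even_edges_uniq.
  + exact: even_vertices_uniq.
  exists (vert (mono n 0 false)); rewrite (vert_compl n_ge4); split.
  + move=> i i_n; have i_gt0 : 0 < i by lia.
    have [odd_i even_i] := letter_low n_ge4 i_gt0.
    by rewrite odd_i ?even_i; lia.
  + by apply/eqP; rewrite mono_neq_compl.
  + exact: even_card_through.
  + exact: even_card_through.
  by move=> u u_cyc ua uca; apply: even_card_through1 => // -[].
move=> n_odd; split; first exact: odd_card_partners.
exists (vert (mono n (2 * uphalf n) false)).
rewrite (vert_compl n_ge4) !(cshift_high n_ge4) //; split.
- split=> i i_n; have i_gt0 : 0 < i by lia.
    by have [odd_i _] := letter_high n_ge4 i_gt0; rewrite odd_i; lia.
  by have [_ even_i] := letter_high n_ge4 i_gt0; apply: even_i; lia.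
(* The vertex [a] has direction [false], both vertices of the other pair have direction [true]. *)
- move=> /setP/(_ (vert (mono n (2 * uphalf n) false))).
  rewrite !inE eqxx (mono_neq_compl n_ge4 _ false (2 * uphalf n)).
  by rewrite (mono_neq_compl n_ge4 _ false 0).
- exact: odd_multi_pairs.
- by rewrite !(card_edges_high n_ge4).
by rewrite !(card_cycles_on_high n_ge4).
Qed.
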